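(* Let $F$ be an ordered forest on $n$ vertices, where $n\geq 2$, and let $H$ be an ordered graph on $m$ vertices. Then $$R_<(F,H)\leq 1+(n-1)^{\lceil \log_2 \chi_<(H)\rceil}(m-1).$$ In particular, $R_<(F,F)=O\bigl(n^{1+\lceil\log_2\chi_<(F)\rceil}\bigr)$, where the implied constant is absolute.
   Context: All graphs are finite and simple, with at least one vertex. An ordered graph is a graph equipped with a linear order on its vertex set; an ordered forest is an ordered graph whose underlying graph is a forest (acyclic). A copy of an ordered graph $G$ in an ordered graph $G'$ is a (not necessarily induced) subgraph of $G'$ isomorphic to $G$ via an order-preserving isomorphism. For ordered graphs $G,H$, the ordered Ramsey number $R_<(G,H)$ is the minimum $N$ such that every red/blue coloring of the edges of the complete graph $K_N$ with linearly ordered vertex set contains a red copy of $G$ or a blue copy of $H$ (as ordered graphs). The interval chromatic number $\chi_<(H)$ is the minimum number of intervals (sets of consecutive vertices in the vertex order), each an independent set, into which $V(H)$ can be partitioned. *)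

(* Defs.v *)
From mathcomp Require Import all_boot all_order.

Set Implicit Arguments.
Unset Strict Implicit.
Unset Printing Implicit Defensive.

Import Order.TTheory.
Local Open Scope order_scope.

Record ograph (d : Order.disp_t) (T : finOrderType d) := OGraph {
  edge :> rel T;
  edge_sym : symmetric edge;
  edge_irr : irreflexive edge }.

Definition is_forest (d : Order.disp_t) (T : finOrderType d) (G : ograph T)
    : Prop :=
  forall s : seq T, (2 < size s)%N -> ~~ ucycleb G s.

(* The copy is the image of f: strictly increasing maps between linear orders
   are injective, and the copy need not be induced. *)
Definition has_copy (d d' : Order.disp_t) (T : finOrderType d)
    (T' : finOrderType d') (G : ograph T) (G' : ograph T') : bool :=
  [exists f : {ffun T -> T'},
    [forall x, forall y, (x < y) ==> (f x < f y)] &&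
    [forall x, forall y, G x y ==> G' (f x) (f y)]].

(* A colouring of the edges of the complete graph on 'I_N: the edge uv is the
   two-element set [set u; v], and true stands for red, false for blue.  The
   values on sets that are not edges are irrelevant. *)
Definition coloring (N : nat) := {ffun {set 'I_N} -> bool}.

Definition color_rel (N : nat) (c : coloring N) (b : bool) : rel 'I_N :=
  fun u v => (u != v) && (c [set u; v] == b).

Lemma color_rel_sym N (c : coloring N) b : symmetric (color_rel c b).
Proof. by move=> u v; rewrite /color_rel eq_sym setUC. Qed.

Lemma color_rel_irr N (c : coloring N) b : irreflexive (color_rel c b).
Proof. by move=> u; rewrite /color_rel eqxx. Qed.

Definition color_class (N : nat) (c : coloring N) (b : bool) : ograph 'I_N :=
  OGraph (color_rel_sym c b) (color_rel_irr c b).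

Definition ramsey_prop (d d' : Order.disp_t) (T : finOrderType d)
    (U : finOrderType d') (G : ograph T) (H : ograph U) (N : nat) : bool :=
  [forall c : coloring N,
    has_copy G (color_class c true) || has_copy H (color_class c false)].

Lemma ramsey_seq (a b : nat) : exists N : nat,
  forall (V : eqType) (r : rel V) (s : seq V), (N <= size s)%N ->
  exists2 t, subseq t s &
    (size t = a /\ pairwise r t) \/
    (size t = b /\ pairwise (fun x y => ~~ r x y) t).
Proof.
elim: a b => [|a IHa] b.
  by exists 0%N => V r s _; exists [::]; [exact: sub0seq | left].
elim: b => [|b [N2 IHb]].
  by exists 0%N => V r s _; exists [::]; [exact: sub0seq | right].
have [N1 IH1] := IHa b.+1.
exists (N1 + N2).+1 => V r [//|x s]; rewrite /= ltnS => le_s.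
have sz : (size (filter (r x) s) + size (filter (predC (r x)) s) = size s)%N.
  by rewrite !size_filter count_predC.
have sub_cons p t : subseq t (filter p s) -> subseq t (x :: s).
  move=> st; apply: subseq_trans (subseq_cons s x).
  exact: subseq_trans st (filter_subseq _ _).
have sub_cons2 p t : subseq t (filter p s) -> subseq (x :: t) (x :: s).
  by move=> st; rewrite /= eqxx; apply: subseq_trans st (filter_subseq _ _).
have all_sub p t : subseq t (filter p s) -> all p t.
  move=> st; apply/allP => y /(mem_subseq st).
  by rewrite mem_filter => /andP[].
have [le1|lt1] := leqP N1 (size (filter (r x) s)).
  have [t st [[<- pt]|[szt pt]]] := IH1 _ r _ le1.
    exists (x :: t); first exact: sub_cons2 st.
    by left; split=> //=; rewrite pt andbT (all_sub _ _ st).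
  by exists t; [exact: sub_cons st | right].
have le2 : (N2 <= size (filter (predC (r x)) s))%N.
  rewrite leqNgt; apply/negP => lt2; move: le_s; rewrite -sz leqNgt.
  by rewrite (leq_trans _ (leq_add lt1 (ltnW lt2))) // addSn ltnS.
have [t st [[szt pt]|[<- pt]]] := IHb _ r _ le2.
  by exists t; [exact: sub_cons st | left].
exists (x :: t); first exact: sub_cons2 st.
by right; split=> //=; rewrite pt andbT (all_sub _ _ st).
Qed.

Lemma has_copy_clique (d : Order.disp_t) (T : finOrderType d) (G : ograph T)
    (N : nat) (c : coloring N) (b : bool) (t : seq 'I_N) :
  subseq t (enum 'I_N) -> size t = #|T| ->
  pairwise (fun u v => c [set u; v] == b) t -> has_copy G (color_class c b).
Proof.
move=> st szt pt.
pose rk (x : T) := #|[set y | y < x]|.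
have rk_lt x y : x < y -> (rk x < rk y)%N.
  move=> xy; apply: proper_card; apply/properP; split.
    by apply/subsetP => z; rewrite !inE => /lt_trans; apply.
  by exists x; rewrite !inE ?ltxx.
have rk_sz x : (rk x < size t)%N.
  rewrite szt -cardsT; apply: proper_card; apply/properP.
  by split; [exact: subsetT | exists x; rewrite !inE ?ltxx].
have stt : pairwise (fun u v : 'I_N => (u < v)%N) t.
  rewrite -sorted_pairwise; last by move=> ? ? ?; exact: ltn_trans.
  apply: subseq_sorted st _; first by move=> ? ? ?; exact: ltn_trans.
  have := iota_ltn_sorted 0 N; rewrite -val_enum_ord sorted_map.
  by apply: sub_sorted.
case: t => [|x0 t'] in szt st pt rk_sz stt *.
  apply/existsP.
  have noT (x : T) : False by have := rk_sz x.
  by exists [ffun x => False_rect _ (noT x)]; apply/andP; split;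
    apply/forallP => x; case: (noT x).
set t := x0 :: t' in szt st pt rk_sz stt.
pose f : {ffun T -> 'I_N} := [ffun x => nth x0 t (rk x)].
have f_lt x y : x < y -> (f x < f y)%N && (c [set f x; f y] == b).
  move=> xy; rewrite !ffunE; apply/andP; split.
    by apply: (pairwiseP x0 stt); rewrite ?inE ?rk_sz ?rk_lt.
  by apply: (pairwiseP x0 pt); rewrite ?inE ?rk_sz ?rk_lt.
apply/existsP; exists f; apply/andP; split.
  by apply/forallP => x; apply/forallP => y; apply/implyP => /f_lt /andP[].
apply/forallP => x; apply/forallP => y; apply/implyP => Gxy.
rewrite /= /color_rel.
case: (ltgtP x y) => [xy|yx|exy]; last by rewrite exy edge_irr in Gxy.
  by have /andP[lt ->] := f_lt _ _ xy; rewrite andbT -val_eqE neq_ltn lt.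
by have /andP[lt cb] := f_lt _ _ yx; rewrite setUC cb andbT -val_eqE neq_ltn lt
   orbT.
Qed.

Lemma ramsey_prop_ex (d d' : Order.disp_t) (T : finOrderType d)
    (U : finOrderType d') (G : ograph T) (H : ograph U) :
  exists N, ramsey_prop G H N.
Proof.
have [N ramN] := ramsey_seq #|T| #|U|.
exists N; apply/forallP => c.
have [|t st [[sz pt]|[sz pt]]] :=
  ramN _ (fun u v => c [set u; v] == true) (enum 'I_N).
- by rewrite size_enum_ord.
- by rewrite (has_copy_clique G st sz pt).
- rewrite (has_copy_clique H st sz) ?orbT //.
  by apply: sub_pairwise pt => u v; case: (c _).
Qed.

Definition ordered_ramsey (d d' : Order.disp_t) (T : finOrderType d)
    (U : finOrderType d') (G : ograph T) (H : ograph U) : nat :=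
  ex_minn (ramsey_prop_ex G H).

Definition is_vertex_interval (d : Order.disp_t) (T : finOrderType d)
    (A : {set T}) : bool :=
  [forall x in A, forall y in A, forall z, (x <= z <= y) ==> (z \in A)].

Definition independent (d : Order.disp_t) (T : finOrderType d)
    (H : ograph T) (A : {set T}) : bool :=
  [forall x in A, forall y in A, ~~ H x y].

Definition interval_colorable (d : Order.disp_t) (T : finOrderType d)
    (H : ograph T) (k : nat) : bool :=
  [exists P : {set {set T}},
    [&& partition P [set: T], #|P| == k &
        [forall A in P, is_vertex_interval A && independent H A]]].

Lemma interval_colorable_ex (d : Order.disp_t) (T : finOrderType d)
    (H : ograph T) : exists k, interval_colorable H k.
Proof.
pose P := preim_partition id [set: T].
exists #|P|; apply/existsP; exists P.
rewrite preim_partitionP eqxx /=; apply/forall_inP => A /imsetP[a _ ->].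
apply/andP; split; apply/forall_inP => x; rewrite !inE => /eqP <-;
  apply/forall_inP => y; rewrite !inE => /eqP <-.
  by apply/forallP => z; rewrite -eq_le !inE; apply/implyP.
by rewrite edge_irr.
Qed.

Definition interval_chromatic_number (d : Order.disp_t) (T : finOrderType d)
    (H : ograph T) : nat :=
  ex_minn (interval_colorable_ex H).

(* Main.v *)
Require Import Defs.
From mathcomp Require Import all_boot all_order.
From mathcomp Require Import zify.

Set Implicit Arguments.
Unset Strict Implicit.
Unset Printing Implicit Defensive.

Import Order.TTheory.

(** Let n = #|T|, and let G be the red graph of a colouring with no red copy
    of the forest F.  A blue copy of H is an order-preserving map from the
    vertices of H to those of G that sends edges to non-edges of G; it is
    built by halving.  Colour H properly, and monotonically in the vertex
    order, with at most 2 ^ k colours ([interval_coloring]).  The lower and the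
    upper half of the colours cut H into an initial part and a final part, with
    m1 and m2 vertices.  If G contains sets A < B with no edge of G between
    them, then the two parts may be placed independently in A and in B: edges
    of H between the parts cause no conflict, and the order is respected.
    Recursively ([embedding_into_complement]), it is enough that A and B have
    more than (n - 1) ^ (k - 1) * (m1 - 1), resp.
    (n - 1) ^ (k - 1) * (m2 - 1), vertices.

    Such a pair comes from [edge_free_pair]: if G has more than
    (n - 1) * (a + b + 1) vertices and no pair A < B with #|A| > a, #|B| > b
    and no edge between, then G contains F.  Cut the vertices of G into
    consecutive blocks W v, one for each vertex v of F.  A map sending each v
    into W v automatically preserves the order, so only the edges of F remain.
    For an edge v < w of F, at most a vertices of W v have no neighbour in a
    given subset of W w with more than b elements, and symmetrically.  Hence v
    may be charged a for every neighbour on its right and b for every neighbour on its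
    left, and blocks having one vertex more than the total charge allow an
    embedding that strips leaves off the forest ([forest_embedding]).  As a
    forest has at most n - 1 edges, each charged a + b, the blocks need
    n + (n - 1) * (a + b) = 1 + (n - 1) * (a + b + 1) vertices altogether
    ([forest_weight]).

    With a = p * (m1 - 1) and b = p * (m2 - 1), where p = (n - 1) ^ (k - 1) is
    at least 1 and m = m1 + m2, one has a + b + 1 <= p * (m - 1); this is why
    each halving step costs exactly a factor n - 1. *)

(** * Forests and leaves *)

Section Forests.

Variables (d : Order.disp_t) (T : finOrderType d) (F : ograph T).
Hypothesis forestF : is_forest F.

(** If every vertex of D had two neighbours in D, then a path in D could always
    be prolonged backwards: its first vertex x has a neighbour y other than the
    second vertex, and y lies off the path, since otherwise the part of the
    path from x to y would close into a cycle.  Paths would thus be arbitrarily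
    long. *)
Lemma forest_leaf (D : {set T}) :
  D != set0 -> exists2 z, z \in D & #|[set w in D | F z w]| <= 1.
Proof.
move=> /set0Pn[x0 x0D]; apply/exists_inP; apply: contraT => /exists_inPn noleaf.
suff longpath k : exists x p, [/\ path F x p, uniq (x :: p),
    {subset x :: p <= D} & size p = k].
  have [x [p [_ uniq_xp _ sz_p]]] := longpath #|T|.
  by have := max_card [in x :: p]; rewrite (card_uniqP uniq_xp) /= sz_p ltnn.
elim: k => [|k [x [p [path_p uniq_p subD sz_p]]]].
  by exists x0, [::]; split=> // y; rewrite inE => /eqP->.
have xD : x \in D by apply: subD; rewrite mem_head.
(* When the path is reduced to x, the default x in [head x p] excludes nothing,
   as x is not its own neighbour. *)
have [y]: exists y, y \in [set w in D | F x w] :\ head x p.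
  apply/set0Pn; rewrite -card_gt0.
  by have := noleaf _ xD; rewrite (cardsD1 (head x p)); case: (_ \in _); lia.
rewrite !inE => /and3P[y_head yD Fxy].
have y_x : y != x by apply: contraTneq Fxy => ->; rewrite edge_irr.
have [y_p|y_p] := boolP (y \in p); last first.
  exists y, (x :: p); rewrite /= edge_sym Fxy path_p sz_p.
  split=> //; first by rewrite inE negb_or y_x y_p.
  by move=> w; rewrite inE => /predU1P[->|/subD].
case/splitPr: y_p => p1 p2 in path_p uniq_p y_head *.
have /negP[] : ~~ ucycleb F (x :: rcons p1 y).
  apply: forestF; rewrite /= size_rcons.
  by case: p1 y_head {path_p uniq_p} => //=; rewrite eqxx.
move: path_p uniq_p; rewrite /ucycleb -cat_rcons cat_path -cat_cons cat_uniq.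
move=> /andP[path_p1 _] /andP[-> _].
by rewrite andbT /= rcons_path path_p1 last_rcons edge_sym.
Qed.

(** Every vertex set of a forest is built by adding vertices that have at most
    one neighbour among those already present. *)
Lemma forest_ind (P : {set T} -> Prop) :
    P set0 ->
    (forall (D : {set T}) z, z \notin D -> #|[set w in D | F z w]| <= 1 ->
      P D -> P (z |: D)) ->
  forall D, P D.
Proof.
move=> P0 PU D; have [k] := ubnP #|D|; elim: k D => // k IHk D leDk.
have [->//|/forest_leaf[z zD leaf_z]] := eqVneq D set0.
rewrite -(setD1K zD); apply: PU; first by rewrite !inE eqxx.
  apply: leq_trans leaf_z; apply/subset_leq_card/subsetP => w.
  by rewrite !inE => /andP[/andP[_ ->] ->].
by apply: IHk; rewrite (cardsD1 z) zD in leDk; lia.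
Qed.

Lemma sum_nbrsU1 (c : T -> T -> nat) (v z : T) (D : {set T}) :
    z \notin D ->
  \sum_(w in z |: D | F v w) c v w =
    F v z * c v z + \sum_(w in D | F v w) c v w.
Proof.
move=> zD; rewrite [LHS]big_mkcondr big_setU1 //= -big_mkcondr.
by case: (F v z); rewrite ?mul1n.
Qed.

(** A forest on D has at most #|D| - 1 edges, and the two directions of an edge
    together weigh at most m.  Double counting and the edge bound are obtained
    at once by adding a vertex z with at most one neighbour: its only edge
    brings both directions. *)
Lemma forest_weight (c : T -> T -> nat) (m : nat) (D : {set T}) :
    (forall v w, F v w -> c v w + c w v <= m) ->
  \sum_(v in D) \sum_(w in D | F v w) c v w <= (#|D| - 1) * m.
Proof.
move=> le_m; elim/forest_ind: D => [|D z zD leaf_z IHD]; first by rewrite big_set0.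
rewrite big_setU1 //=.
have splitz v := sum_nbrsU1 c v zD.
rewrite (eq_bigr _ (fun v _ => splitz v)) splitz edge_irr big_split /=.
rewrite addnA mul0n add0n.
have ->: \sum_(v in D) F v z * c v z = \sum_(v in D | F z v) c v z.
  rewrite [RHS]big_mkcondr; apply: eq_bigr => v _.
  by rewrite edge_sym; case: (F z v); rewrite ?mul1n.
rewrite -big_split /=.
have: \sum_(w in D | F z w) (c z w + c w z) <= #|[set w in D | F z w]| * m.
  rewrite -sum_nat_const; under [X in _ <= X]eq_bigl do rewrite inE.
  by apply: leq_sum => w /andP[_ /le_m].
have nb_D : #|[set w in D | F z w]| <= #|D|.
  by apply/subset_leq_card/subsetP => w; rewrite inE => /andP[].
(* A vertex added to the empty set brings no edge, whence the bound by #|D|. *)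
have nb_le : #|[set w in D | F z w]| + (#|D| - 1) <= #|z |: D| - 1.
  by rewrite cardsU1 zD; lia.
move=> le_nb; apply: leq_trans (leq_add le_nb IHD) _.
by rewrite -mulnDl leq_mul2r nb_le orbT.
Qed.

Section Embedding.

Variables (d' : Order.disp_t) (V : finOrderType d') (G : ograph V).

(** Here c v w is the number of vertices of W v that may be lost on account of
    the neighbour w.  To add a leaf z attached to u, discard the vertices of
    W u that have no neighbour in W z: there are at most c u z of them, as
    W z has more than c z u vertices.  This is exactly what u no longer has to
    pay once z is removed, so that the rest embeds by induction, and the image
    of u then has a neighbour in W z for the image of z. *)
Lemma forest_embedding (c : T -> T -> nat) (W : T -> {set V}) (x0 : V)
    (D : {set T}) :
    (forall v w (X Y : {set V}), F v w -> X \subset W v -> Y \subset W w ->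
       c v w < #|X| -> c w v < #|Y| ->
       exists x y, [/\ x \in X, y \in Y & G x y]) ->
    (forall v, v \in D -> \sum_(w in D | F v w) c v w < #|W v|) ->
  exists f : T -> V, (forall v, v \in D -> f v \in W v) /\
    (forall v w, v \in D -> w \in D -> F v w -> G (f v) (f w)).
Proof.
elim/forest_ind: D W => [|D z zD leaf_z IHD] W dense big_W.
  by exists (fun=> x0); split=> v; rewrite inE.
have splitz v := sum_nbrsU1 c v zD.
(* The sets are shrunk for all neighbours of z uniformly; that there is at most
   one matters only for choosing the image y of z. *)
pose good v := [set x in W v | F z v ==> [exists y in W z, G x y]].
have good_sub v : good v \subset W v by apply/subsetP => x; rewrite inE => /andP[].
have big_z w : w \in D -> F z w -> c z w < #|W z|.
  move=> wD Fzw; apply: leq_ltn_trans (big_W z (setU11 _ _)).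
  by rewrite splitz (bigD1 w) ?wD //=; lia.
have few_bad v : v \in D -> F z v -> #|W v :\: good v| <= c v z.
  move=> vD Fzv; rewrite leqNgt; apply/negP => many.
  have [||x [y []]] := dense v z _ (W z) _ _ (subxx _) many (big_z v vD Fzv).
  - by rewrite edge_sym.
  - exact: subsetDl.
  rewrite !inE Fzv negb_and => /andP[/orP[/negP//|/exists_inPn noy] _] yWz Gxy.
  by have /negP := noy _ yWz.
have [||f [fW fG]] := IHD good.
- move=> v w X Y Fvw Xv Yw; apply: dense Fvw _ _.
    exact: subset_trans Xv (good_sub v).
  exact: subset_trans Yw (good_sub w).
- move=> v vD; have := big_W v (setU1r _ vD); rewrite splitz edge_sym.
  have := cardsID (good v) (W v); rewrite (setIidPr (good_sub v)).
  have [/(few_bad v vD)|/negbTE Fzv] := boolP (F z v); first by rewrite mul1n; lia.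
  rewrite mul0n => _; suff -> : good v = W v by [].
  by apply/setP => x; rewrite inE Fzv andbT.
have [y yWz yG]: exists2 y, y \in W z & forall w, w \in D -> F z w -> G (f w) y.
  have [nb0|/set0Pn[u]] := eqVneq [set w in D | F z w] set0.
    have /card_gt0P[y yWz] : 0 < #|W z|.
      by apply: leq_ltn_trans (big_W z (setU11 _ _)).
    exists y => // w wD Fzw.
    by have : w \in [set w in D | F z w]; [rewrite inE wD | rewrite nb0 inE].
  move=> uN; have := uN; rewrite inE => /andP[uD Fzu].
  have := fW u uD; rewrite inE Fzu => /andP[_ /exists_inP[y yWz Gy]].
  exists y => // w wD Fzw.
  have wN : w \in [set w in D | F z w] by rewrite inE wD.
  by rewrite (card_le1P leaf_z _ uN w) inE in wN; rewrite (eqP wN).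
exists (fun v => if v == z then y else f v); split=> [v|v w].
  rewrite !inE; case: eqP => [-> //|_ /= /fW].
  exact: (subsetP (good_sub v)).
rewrite !inE; case: eqP => [->|_] /=; case: eqP => [->|_] //=.
- by rewrite edge_irr.
- by move=> _ wD Fzw; rewrite edge_sym yG.
- by move=> vD _ Fvz; rewrite yG // edge_sym.
- exact: fG.
Qed.

End Embedding.

End Forests.

(** * Consecutive blocks and pairs without edges *)

Lemma consecutive_blocks (d d' : Order.disp_t) (T : finOrderType d)
    (V : finOrderType d') (S : {set V}) (k : T -> nat) :
    \sum_v k v <= #|S| ->
  exists W : T -> {set V}, [/\ forall v, W v \subset S,
    forall v, #|W v| = k v &
    forall u v, (u < v)%O -> forall x y, x \in W u -> y \in W v -> (x < y)%O].
Proof.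
move=> le_S; pose s := sort <=%O (enum S).
pose off v := \sum_(w | (w < v)%O) k w.
have s_uniq : uniq s by rewrite sort_uniq enum_uniq.
have s_size : size s = #|S| by rewrite size_sort -cardE.
have s_sorted : pairwise <%O s by rewrite -lt_sorted_pairwise sort_lt_sorted enum_uniq.
have off_next v (P : pred T) : P v -> (forall w, (w < v)%O -> P w) ->
    off v + k v <= \sum_(w | P w) k w.
  move=> Pv Pw; rewrite (bigD1 v) //= addnC leq_add2l /off.
  rewrite big_mkcond [X in _ <= X]big_mkcond /=; apply: leq_sum => w _.
  by case: ifP => // lt_wv; rewrite (Pw w lt_wv) lt_eqF.
have off_all v : off v + k v <= size s.
  by rewrite s_size; apply: leq_trans (off_next v xpredT _ _) le_S.
exists (fun v => [set x in take (k v) (drop (off v) s)]); split=> [v|v|u v uv x y].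
- apply/subsetP => x; rewrite inE => /mem_take/mem_drop.
  by rewrite mem_sort mem_enum.
- rewrite cardsE (card_uniqP _) ?take_uniq ?drop_uniq //.
  apply: size_takel; rewrite size_drop leq_subRL ?off_all //.
  by apply: leq_trans (off_all v); apply: leq_addr.
- rewrite !inE => xu /mem_take yv.
  have xv : x \in take (off v) s.
    have le_uv : k u + off u <= off v.
      by rewrite addnC off_next // => w /lt_trans; apply.
    move: xu; rewrite take_drop => /mem_drop.
    by rewrite -(take_takel s le_uv) => /mem_take.
  move: s_sorted; rewrite -{1}(cat_take_drop (off v) s) pairwise_cat.
  by case/and3P => /allrelP ->.
Qed.

(** Without such a pair, every two large enough subsets of two blocks are joined
    by an edge, and the forest embeds in consecutive blocks; the bound on #|S|
    is the total size that the blocks need. *)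
Lemma edge_free_pair (d d' : Order.disp_t) (T : finOrderType d)
    (V : finOrderType d') (F : ograph T) (G : ograph V) (S : {set V})
    (a b : nat) :
    is_forest F -> ~~ has_copy F G -> (#|T| - 1) * (a + b + 1) < #|S| ->
  exists A B : {set V}, [/\ A \subset S, B \subset S, a < #|A|, b < #|B| &
    forall x y, x \in A -> y \in B -> (x < y)%O && ~~ G x y].
Proof.
move=> forestF noF big_S.
pose sparse := [exists A : {set V}, exists B : {set V},
  [&& A \subset S, B \subset S, a < #|A|, b < #|B| &
    [forall x in A, forall y in B, (x < y)%O && ~~ G x y]]].
have [/existsP[A /existsP[B /and5P[AS BS aA bB /forall_inP AB]]]|dense] := boolP sparse.
  by exists A, B; split=> // x y /AB/forall_inP; apply.
case/negP: noF.
(* What v may lose on account of w: at most a vertices of a left block, or b of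
   a right block, have no neighbour in a large part of the other block. *)
pose c (v w : T) := if (v < w)%O then a else b.
pose k v := (\sum_(w | F v w) c v w).+1.
have sum_k : \sum_v k v <= #|S|.
  have := @forest_weight _ _ _ forestF c (a + b) setT.
  have -> : \sum_v k v = #|T| + \sum_(v in [set: T]) \sum_(w in [set: T] | F v w) c v w.
    rewrite /k; under eq_bigr do rewrite -add1n.
    rewrite big_split /= sum1_card; congr (_ + _).
    by apply: eq_big => [v|v _]; rewrite ?inE //; apply: eq_bigl => w; rewrite inE.
  rewrite cardsT => le_w; apply: leq_trans big_S.
  have /le_w sum_w : forall v w, F v w -> c v w + c w v <= a + b.
    by move=> v w Fvw; rewrite /c; case: ltgtP Fvw => [||->]; rewrite ?edge_irr //; lia.
  by rewrite (mulnDr _ (a + b)) muln1 -addnS addnC leq_add // subn1 leqSpred.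
have [W [WS W_card W_lt]] := consecutive_blocks sum_k.
have /card_gt0P[x0 _] : 0 < #|S| by apply: leq_ltn_trans big_S.
have dense_lt v w (X Y : {set V}) : (v < w)%O -> X \subset W v -> Y \subset W w ->
    a < #|X| -> b < #|Y| -> exists x y, [/\ x \in X, y \in Y & G x y].
  move=> vw Xv Yw aX bY; move: dense; rewrite negb_exists => /forallP/(_ X).
  rewrite negb_exists => /forallP/(_ Y).
  rewrite (subset_trans Xv) // (subset_trans Yw) // aX bY /= negb_forall_in.
  case/exists_inP => x xX; rewrite negb_forall_in => /exists_inP[y yY].
  rewrite (W_lt _ _ vw) ?(subsetP Xv) ?(subsetP Yw) //= negbK => Gxy.
  by exists x, y.
have [||f [fW fG]] := forest_embedding forestF (G := G) (c := c) (W := W) x0 (D := setT).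
- move=> v w X Y Fvw Xv Yw; rewrite /c.
  case: (ltgtP v w) => [vw|wv|evw]; last by rewrite evw edge_irr in Fvw.
    exact: dense_lt vw Xv Yw.
  move=> bX aY; have [y [x [yY xX Gyx]]] := dense_lt _ _ _ _ wv Yw Xv aY bX.
  by exists x, y; rewrite edge_sym.
- move=> v _; rewrite W_card ltnS; apply/eq_leq/eq_bigl => w.
  by rewrite inE.
apply/existsP; exists [ffun v => f v]; apply/andP; split.
  apply/forallP => v; apply/forallP => w; apply/implyP => vw; rewrite !ffunE.
  by apply: W_lt vw _ _ _ _; apply: fW.
apply/forallP => v; apply/forallP => w; apply/implyP => Fvw; rewrite !ffunE.
exact: fG.
Qed.

(** * Halving the colours of H *)

(** The colour of x is the number of intervals lying entirely below x.  If two
    vertices x < y have the same colour, then the interval of x, not being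
    below x, is not below y either; it therefore reaches y, and x and y lie in
    one independent interval. *)
Lemma interval_coloring (d : Order.disp_t) (U : finOrderType d) (H : ograph U)
    (q : nat) :
    interval_colorable H q ->
  exists g : U -> nat, [/\ forall x, g x < q,
    forall x y, (x <= y)%O -> g x <= g y & forall x y, H x y -> g x != g y].
Proof.
case/existsP => P /and3P[partP /eqP <- /forall_inP intP].
have [/eqP covP trivP _] := and3P partP.
pose below x := [set A in P | [forall a in A, (a < x)%O]].
have block_mem x : x \in pblock P x by rewrite mem_pblock covP inE.
have block_P x : pblock P x \in P by rewrite pblock_mem // covP inE.
have block_below x : pblock P x \notin below x.
  rewrite inE block_P; apply/negP => /forall_inP/(_ x (block_mem x)).
  by rewrite ltxx.
have below_mono x y : (x <= y)%O -> below x \subset below y.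
  move=> xy; apply/subsetP => A; rewrite !inE => /andP[-> /forall_inP Ax].
  by apply/forall_inP => a /Ax/lt_le_trans; apply.
have neq_lt x y : (x < y)%O -> H x y -> #|below x| != #|below y|.
  move=> xy Hxy; apply/eqP => exy.
  have /eqP bxy : below x == below y.
    by rewrite eqEcard below_mono ?ltW // exy leqnn.
  have := block_below x; rewrite bxy inE block_P negb_forall_in.
  case/exists_inP => a aB; rewrite -leNgt => ya.
  have /andP[/forall_inP ivl /forall_inP ind] := intP _ (block_P x).
  have yB : y \in pblock P x.
    have /forall_inP/(_ a aB)/forallP/(_ y)/implyP := ivl x (block_mem x).
    by apply; rewrite (ltW xy).
  by have /forall_inP/(_ y yB)/negP := ind x (block_mem x).
exists (fun x => #|below x|); split=> [x|x y|x y Hxy].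
- apply: proper_card; apply/properP; split.
    by apply/subsetP => A; rewrite inE => /andP[].
  by exists (pblock P x).
- by move/below_mono/subset_leq_card.
- case: (ltgtP x y) => [xy|yx|exy]; last by rewrite exy edge_irr in Hxy.
    exact: neq_lt.
  by rewrite eq_sym neq_lt // edge_sym.
Qed.

(** The colours used on D form an interval of length 2 ^ k, whose two halves are
    treated separately, in the two sides of an edge-free pair.  The offset lo
    is what lets the induction apply to the upper half.  When one half is
    unused, D itself falls in the other one and S has room to spare. *)
Lemma embedding_into_complement (d1 d2 d3 : Order.disp_t) (T : finOrderType d1)
    (U : finOrderType d2) (V : finOrderType d3) (F : ograph T) (H : ograph U)
    (G : ograph V) (g : U -> nat) (k lo : nat) (D : {set U}) (S : {set V}) :
    1 < #|T| -> is_forest F -> ~~ has_copy F G ->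
    (forall x y, (x <= y)%O -> g x <= g y) ->
    (forall x y, H x y -> g x != g y) ->
    (forall x, x \in D -> lo <= g x < lo + 2 ^ k) ->
    D != set0 -> (#|T| - 1) ^ k * (#|D| - 1) < #|S| ->
  exists f : U -> V, [/\ forall x, x \in D -> f x \in S,
    forall x y, x \in D -> y \in D -> (x < y)%O -> (f x < f y)%O &
    forall x y, x \in D -> y \in D -> H x y -> ~~ G (f x) (f y)].
Proof.
move=> T_gt1 forestF noF g_mono g_proper.
elim: k lo D S => [|k IHk] lo D S gD D_n0 big_S.
  (* One colour: D spans no edge, and any increasing map to S will do; blocks of
     size one supply it. *)
  have [|W [WS W_card W_lt]] := @consecutive_blocks _ _ U V S (fun x => x \in D).
    have -> : \sum_x (x \in D : nat) = #|D|.
      by rewrite -sum1_card [RHS]big_mkcond; apply: eq_bigr => x _; case: ifP.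
    move: D_n0 big_S; rewrite -card_gt0.
    by rewrite mul1n; case: #|D|; lia.
  have /card_gt0P[x0 _] : 0 < #|S| by apply: leq_ltn_trans big_S.
  pose f x := odflt x0 [pick y in W x].
  have fW x : x \in D -> f x \in W x.
    move=> xD; rewrite /f; case: pickP => //= W0.
    by have := W_card x; rewrite xD (eq_card0 W0).
  exists f; split=> [x /fW||x y /gD gx /gD gy /g_proper].
  - exact: (subsetP (WS x)).
  - by move=> x y /fW xW /fW yW xy; apply: W_lt xW yW.
  - by move: gx gy; rewrite expn0; lia.
pose D1 := [set x in D | g x < lo + 2 ^ k]; pose D2 := D :\: D1.
have D12 : #|D1| + #|D2| = #|D|.
  rewrite -(cardsID D1 D) (setIidPr _) //.
  by apply/subsetP => x; rewrite inE => /andP[].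
have gD1 x : x \in D1 -> lo <= g x < lo + 2 ^ k.
  by rewrite inE => /andP[/gD/andP[-> _] ->].
have gD2 x : x \in D2 -> lo + 2 ^ k <= g x < lo + 2 ^ k + 2 ^ k.
  rewrite !inE => /andP[+ xD]; rewrite xD -leqNgt => ->.
  by have := gD x xD; rewrite expnS; lia.
pose p := (#|T| - 1) ^ k.
have p_gt0 : 0 < p by rewrite expn_gt0; lia.
have small : p * (#|D| - 1) < #|S|.
  apply: leq_ltn_trans big_S; rewrite expnS -/p -mulnA leq_pmull //; lia.
have [D10|D1_n0] := eqVneq D1 set0.
  have D2D : D2 = D by rewrite /D2 D10 setD0.
  by apply: (IHk (lo + 2 ^ k)) => // x; rewrite -D2D => /gD2.
have [D20|D2_n0] := eqVneq D2 set0.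
  have DD1 x : x \in D -> x \in D1.
    by move=> xD; apply: contraT => xD1; rewrite -(in_set0 x) -D20 inE xD1.
  by apply: (IHk lo) => // x /DD1/gD1.
have [|A [B [AS BS big_A big_B AB]]] := @edge_free_pair _ _ T V F G S
    (p * (#|D1| - 1)) (p * (#|D2| - 1)) forestF noF.
  apply: leq_ltn_trans big_S; rewrite expnS -/p -mulnA leq_mul2l; apply/orP; right.
  by move: D1_n0 D2_n0; rewrite -!card_gt0 -D12; nia.
have [f1 [f1A f1_lt f1G]] := IHk _ _ _ gD1 D1_n0 big_A.
have [f2 [f2B f2_lt f2G]] := IHk _ _ _ gD2 D2_n0 big_B.
have inD2 x : x \in D -> x \notin D1 -> x \in D2 by rewrite !(inE, negb_and) => -> ->.
exists (fun x => if x \in D1 then f1 x else f2 x); split.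
- move=> x xD; case: ifPn => [/f1A|/(inD2 x xD)/f2B]; exact: subsetP.
- move=> x y xD yD xy; case: ifPn => xD1; case: ifPn => yD1.
  + exact: f1_lt.
  + by have /andP[] := AB _ _ (f1A x xD1) (f2B y (inD2 y yD yD1)).
  + have := g_mono _ _ (ltW xy); have := gD1 y yD1.
    by have := gD2 x (inD2 x xD xD1); lia.
  + by apply: f2_lt => //; apply: inD2.
- move=> x y xD yD Hxy; case: ifPn => xD1; case: ifPn => yD1.
  + exact: f1G.
  + by have /andP[] := AB _ _ (f1A x xD1) (f2B y (inD2 y yD yD1)).
  + rewrite edge_sym.
    by have /andP[] := AB _ _ (f1A y yD1) (f2B x (inD2 x xD xD1)).
  + by apply: f2G => //; apply: inD2.
Qed.

Lemma ordered_ramsey_forest (d d' : Order.disp_t) (T : finOrderType d)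
    (U : finOrderType d') (F : ograph T) (H : ograph U) :
    1 < #|T| -> 0 < #|U| -> is_forest F ->
  ordered_ramsey F H
    <= 1 + (#|T| - 1) ^ up_log 2 (interval_chromatic_number H) * (#|U| - 1).
Proof.
move=> T_gt1 U_gt0 forestF; rewrite /ordered_ramsey /interval_chromatic_number.
case: (ex_minnP (interval_colorable_ex H)) => q.
case/interval_coloring => g [g_lt g_mono g_proper] _.
case: ex_minnP => r _; apply; apply/forallP => c.
rewrite -implyNb; apply/implyP => noF.
have [|||f [_ f_lt fG]] := embedding_into_complement (k := up_log 2 q) (lo := 0)
    (D := setT) (S := setT) T_gt1 forestF noF g_mono g_proper.
- by move=> x _; rewrite (leq_trans (g_lt x)) // up_logP.
- by rewrite -card_gt0 cardsT.
- by rewrite !cardsT card_ord.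
have {}f_lt x y : (x < y)%O -> (f x < f y)%O by apply: f_lt; rewrite inE.
apply/existsP; exists [ffun x => f x]; apply/andP; split.
  by apply/forallP => x; apply/forallP => y; apply/implyP; rewrite !ffunE; apply: f_lt.
apply/forallP => x; apply/forallP => y; apply/implyP => Hxy; rewrite !ffunE.
have fxy : f x != f y.
  case: (ltgtP x y) => [/f_lt/lt_eqF->|/f_lt/gt_eqF->|exy] //.
  by rewrite exy edge_irr in Hxy.
have := fG x y; rewrite !inE => /(_ isT isT Hxy).
by rewrite /= /color_rel fxy /=; case: (c _).
Qed.

(* up_log 2 k is the ceiling of log_2 k for k >= 1. *)
Theorem theorem1p1 :
  (forall (d d' : Order.disp_t) (T : finOrderType d) (U : finOrderType d')
      (F : ograph T) (H : ograph U) (n m : nat),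
    #|T| = n -> #|U| = m -> 2 <= n -> 1 <= m -> is_forest F ->
    ordered_ramsey F H
      <= 1 + (n - 1) ^ up_log 2 (interval_chromatic_number H) * (m - 1))
  /\
  (exists C : nat,
    forall (d : Order.disp_t) (T : finOrderType d) (F : ograph T) (n : nat),
    #|T| = n -> 2 <= n -> is_forest F ->
    ordered_ramsey F F
      <= C * n ^ (1 + up_log 2 (interval_chromatic_number F))).
Proof.
split=> [d d' T U F H n m <- <- |]; first exact: ordered_ramsey_forest.
(* The constant is 1, as 1 + (n - 1) ^ k.+1 <= n ^ k.+1. *)
exists 1 => d T F n <- T_gt1 forestF; rewrite mul1n.
apply: leq_trans (ordered_ramsey_forest F T_gt1 (ltnW T_gt1) forestF) _.
by rewrite add1n mulnC -expnS ltn_exp2r // subn1 ltn_predL ltnW.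
Qed.
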